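(* Let $\alpha$ be an irrational number with $0<\alpha<1/2$, with continued fraction expansion $\alpha=[0;d_1+1,d_2,d_3,\ldots]$ (so $d_i\geq 1$ for all $i\geq1$), and let $s$ be a Sturmian word of slope $\alpha$. Then the Lie complexity $L_s$ of $s$ satisfies: $L_s(0)=1$; $L_s(n)=2$ for $1\leq n\leq q_1$; and for $n>q_1$, $L_s(n)=1$ if $n=q_{k,\ell}$ for some $k\geq 2$ and $1\leq \ell<d_k$, or $n=mq_k$ for some $k\geq 1$ and $1\leq m\leq d_{k+1}+1$; and $L_s(n)=0$ otherwise.
   Context: For an irrational $0<\alpha<1$ and a real $\rho$, the Sturmian word $s_{\alpha,\rho}$ over $\{0,1\}$ is defined by $s_{\alpha,\rho}(n)=\lfloor \alpha(n+1)+\rho\rfloor-\lfloor \alpha n+\rho\rfloor$ for $n\geq 0$; a Sturmian word of slope $\alpha$ is $s_{\alpha,\rho}$ for some real $\rho$. The denominators of convergents are defined by $q_0=1$, $q_1=d_1+1$, and $q_k=d_kq_{k-1}+q_{k-2}$ for $k\geq 2$ (so $q_k$ is the denominator of $[0;d_1+1,d_2,\ldots,d_k]$). For $k\geq2$ and $1\leq\ell<d_k$, $q_{k,\ell}=\ell q_{k-1}+q_{k-2}$ (the denominator of the semiconvergent $[0;d_1+1,d_2,\ldots,d_{k-1},\ell]$). The Lie complexity $L_s(n)$ of an infinite word $s$ is the number of conjugacy classes (under cyclic shift) of words of length $n$ such that every element of the class is a factor of $s$ (for $n=0$ the class of the empty word counts). *)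

(* Defs.v *)
From HB Require Import structures.
From mathcomp Require Import all_boot all_order all_algebra.
From mathcomp Require Import boolp classical_sets reals topology normedtype sequences.

Set Implicit Arguments.
Unset Strict Implicit.
Unset Printing Implicit Defensive.

Import Order.TTheory GRing.Theory Num.Theory.
Import numFieldNormedType.Exports.

Section LieComplexity.
Variable A : finType.

Definition factor (s : nat -> A) (w : seq A) : Prop :=
  exists i : nat, w = mkseq (fun j => s (i + j)) (size w).

Definition conj_class (n : nat) (w : n.-tuple A) : {set n.-tuple A} :=
  [set v : n.-tuple A | [exists k : 'I_n.+1, tval v == rot k w]]%SET.

Definition conj_classes (n : nat) : {set {set n.-tuple A}} :=
  [set conj_class w | w : n.-tuple A]%SET.

Definition Lie_complexity (s : nat -> A) (n : nat) : nat :=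
  #|[set C in conj_classes n | [forall v in C, `[< factor s (tval v) >]]]%SET|.

End LieComplexity.

Local Open Scope ring_scope.

(* The letters 0 and 1 are the booleans false and true. *)
Definition Sturmian_word (R : realType) (alpha : R) (s : nat -> bool) : Prop :=
  exists rho : R, forall n : nat,
    (s n)%:Z = Num.floor (alpha * n.+1%:R + rho) - Num.floor (alpha * n%:R + rho).

(* [a 0; a 1, ..., a n] *)
Fixpoint cfrac (R : realType) (a : nat -> nat) (n : nat) : R :=
  match n with
  | 0%N => (a 0%N)%:R
  | m.+1 => (a 0%N)%:R + (cfrac R (fun i => a i.+1) m)^-1
  end.

Definition has_cfrac (R : realType) (x : R) (a : nat -> nat) : Prop :=
  (cfrac R a n @[n --> \oo] --> x)%classic.

Local Close Scope ring_scope.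

(* The partial quotients of [0; d_1 + 1, d_2, d_3, ...]; the value d 0 of the
   sequence d is never used. *)
Definition slope_quotients (d : nat -> nat) (i : nat) : nat :=
  match i with
  | 0 => 0
  | 1 => d 1 + 1
  | _ => d i
  end.

Fixpoint q (d : nat -> nat) (k : nat) : nat :=
  match k with
  | 0 => 1
  | 1 => d 1 + 1
  | (k2.+1 as k1).+1 => d k1.+1 * q d k1 + q d k2
  end.

(* Only meaningful for k >= 2 and 1 <= l < d k. *)
Definition q_semi (d : nat -> nat) (k l : nat) : nat :=
  l * q d (k - 1) + q d (k - 2).

(* Main.v *)
(** Let [w] have length [n] and [p] ones. If every conjugate of [w] is a factor
    of [s], then averaging the height differences of the periodic word [w^oo]
    over all starting points shows that [w^oo] has heights [floor (p j / n)] up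
    to a shift, and that no fraction of denominator at most [n] lies strictly
    between [p / n] and [alpha]; the converse follows from the density of the
    orbit of an irrational rotation.  Hence [L_s(n)] is the number of Farey
    neighbours [a / b] of [alpha] of order [n] such that [b] divides [n].  For
    [n > q_1] the two neighbours have denominators [q_k] and
    [l q_k + q_(k-1)] with [1 <= l <= d_(k+1)], where
    [l q_k + q_(k-1) <= n < (l + 1) q_k + q_(k-1)]; they are coprime, at least
    [2] and of sum larger than [n], so at most one of them divides [n]. *)

Require Import Defs.
From HB Require Import structures.
From mathcomp Require Import all_boot all_order all_algebra.
From mathcomp Require Import boolp classical_sets reals topology normedtype sequences.
From mathcomp Require Import zify ring lra.

Set Implicit Arguments.
Unset Strict Implicit.
Unset Printing Implicit Defensive.

Import Order.TTheory GRing.Theory Num.Theory.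
Import numFieldNormedType.Exports.

(** * Convergents and their determinants *)

Section ContinuedFractions.
Local Open Scope ring_scope.

(** Both recursions peel off the first partial quotient, as [cfrac] does; the recurrence at the last
    quotient is [cf_recurrence]. *)
Fixpoint cf_num (a : nat -> nat) (n : nat) : nat :=
  match n with
  | 0%N => a 0%N
  | m.+1 => (a 0 * cf_num (fun i => a i.+1) m + cf_den (fun i => a i.+1) m)%N
  end
with cf_den (a : nat -> nat) (n : nat) : nat :=
  match n with
  | 0%N => 1%N
  | m.+1 => cf_num (fun i => a i.+1) m
  end.

Lemma cf_recurrence (a : nat -> nat) (n : nat) :
  (cf_num a n.+2 = a n.+2 * cf_num a n.+1 + cf_num a n)%N /\
  (cf_den a n.+2 = a n.+2 * cf_den a n.+1 + cf_den a n)%N.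
Proof.
elim: n a => [|n IHn] a; first by rewrite /=; lia.
have [IHnum IHden] := IHn (fun i => a i.+1).
have numS b m : cf_num b m.+1
    = (b 0 * cf_num (fun i => b i.+1) m + cf_den (fun i => b i.+1) m)%N by [].
have denS b m : cf_den b m.+1 = cf_num (fun i => b i.+1) m by [].
split; last by rewrite !denS IHnum.
by rewrite (numS a n.+2) (numS a n.+1) (numS a n) IHnum IHden; ring.
Qed.

Lemma cf_num_gt0 (a : nat -> nat) (n : nat) :
  (forall i, (0 < a i)%N) -> (0 < cf_num a n)%N.
Proof.
elim: n a => [|n IHn] a a_gt0 //=.
by rewrite addn_gt0 muln_gt0 a_gt0 IHn.
Qed.

Lemma cf_den_gt0 (a : nat -> nat) (n : nat) :
  (forall i, (0 < a i.+1)%N) -> (0 < cf_den a n)%N.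
Proof. by case: n => //= n a_gt0; exact: cf_num_gt0. Qed.

Lemma cfracE (R : realType) (a : nat -> nat) (n : nat) :
  (forall i, (0 < a i.+1)%N) ->
  cfrac R a n = (cf_num a n)%:R / (cf_den a n)%:R.
Proof.
elim: n a => [|n IHn] a a_gt0 /=; first by rewrite divr1.
rewrite IHn ?invf_div ?natrD ?natrM //.
have num_neq0 : (cf_num (fun i => a i.+1) n)%:R != 0 :> R.
  by rewrite pnatr_eq0 -lt0n cf_num_gt0.
by rewrite mulrDl mulfK.
Qed.

Lemma cf_det (a : nat -> nat) (n : nat) :
  (cf_num a n.+1 * cf_den a n)%:Z =
  (cf_num a n * cf_den a n.+1)%:Z + (-1) ^+ n.
Proof.
elim: n => [|n IHn]; first by rewrite /= !muln1 addn1 mulnC -addn1 PoszD.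
have [-> ->] := cf_recurrence a n.
rewrite exprS; move: IHn.
move: (cf_num a n.+1) (cf_den a n.+1) (cf_num a n) (cf_den a n) => N1 D1 N0 D0.
by rewrite !PoszM !PoszD !PoszM; set e := (-1) ^+ n; nra.
Qed.

(** As a function of [i], [X] obeys the recurrence of the convergents with initial values 0 and 1,
    so it stays nonnegative: all later convergents lie weakly on one side of the [m]-th. *)
Lemma cf_det_shift (a : nat -> nat) (m i : nat) :
  exists X : nat, (cf_num a (m + i) * cf_den a m)%:Z =
  (cf_num a m * cf_den a (m + i))%:Z + (-1) ^+ m * X%:Z.
Proof.
suff [] : (exists X : nat, (cf_num a (m + i) * cf_den a m)%:Z =
    (cf_num a m * cf_den a (m + i))%:Z + (-1) ^+ m * X%:Z) /\
  (exists X : nat, (cf_num a (m + i.+1) * cf_den a m)%:Z =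
    (cf_num a m * cf_den a (m + i.+1))%:Z + (-1) ^+ m * X%:Z) by [].
elim: i => [|i [[X HX] [Y HY]]].
  rewrite addn0 addn1; split; first by exists 0%N; rewrite mulr0 addr0.
  by exists 1%N; rewrite mulr1 cf_det.
split; first by exists Y.
exists (a (m + i).+2 * Y + X)%N; rewrite !addnS.
have [-> ->] := cf_recurrence a (m + i).
move: HX (congr1 ( *%R (a (m + i).+2)%:Z) HY); rewrite !addnS.
move: (cf_num a (m + i).+1) (cf_den a (m + i).+1) (cf_num a (m + i)) => N1 D1 N0.
move: (cf_den a (m + i)) (cf_num a m) (cf_den a m) => D0 N D.
by rewrite !PoszM !PoszD !PoszM; set e := (-1) ^+ m; nra.
Qed.

End ContinuedFractions.

(** * Approximation of [alpha] by its convergents *)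

Section Approximation.
Local Open Scope ring_scope.

Lemma irrational_neq_natr (R : realType) (alpha : R) (a b : nat) :
  irrational alpha -> (0 < b)%N -> alpha * b%:R != a%:R.
Proof.
move=> alpha_irr b_gt0; apply/eqP => ab; apply: alpha_irr; apply/rationalP.
exists a%:Z, b; rewrite -[X in X / _]/(a%:R : R) -ab mulfK //.
by rewrite pnatr_eq0 -lt0n.
Qed.

Lemma natr_cf_det (R : realType) (a : nat -> nat) (n : nat) :
  (cf_num a n.+1)%:R * (cf_den a n)%:R =
  (cf_num a n)%:R * (cf_den a n.+1)%:R + (-1) ^+ n :> R.
Proof.
have /(congr1 (fun z : int => z%:~R : R)) := cf_det a n.
by rewrite rmorphD rmorphXn /= rmorphN1 -!pmulrn !natrM.
Qed.

(** The one-sidedness in [cf_det_shift] passes to the limit [alpha], and irrationality makes it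
    strict. *)
Lemma cf_side (R : realType) (alpha : R) (a : nat -> nat) (m : nat) :
  (forall i, (0 < a i.+1)%N) -> irrational alpha -> has_cfrac alpha a ->
  0 < (-1) ^+ m * (alpha * (cf_den a m)%:R - (cf_num a m)%:R).
Proof.
move=> a_gt0 alpha_irr alpha_cf.
have neq0 : alpha * (cf_den a m)%:R - (cf_num a m)%:R != 0.
  by rewrite subr_eq0 irrational_neq_natr // cf_den_gt0.
rewrite lt0r mulf_neq0 ?signr_eq0 //=.
have lim_m : ((-1) ^+ m * (cfrac R a n * (cf_den a m)%:R - (cf_num a m)%:R)
    @[n --> \oo] -->
  (-1) ^+ m * (alpha * (cf_den a m)%:R - (cf_num a m)%:R))%classic.
  apply: cvgM; first exact: cvg_cst.
  apply: cvgB; last exact: cvg_cst.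
  by apply: cvgM => //; exact: cvg_cst.
apply: cvgr_to_ge lim_m _; exists m => //= n /= le_mn.
have [X] := cf_det_shift a m (n - m); rewrite subnKC //.
move=> /(congr1 (fun z : int => z%:~R : R)).
rewrite intrD intrM rmorphXn /= rmorphN1 -!pmulrn !natrM => HX.
have den_gt0 : 0 < (cf_den a n)%:R :> R by rewrite ltr0n cf_den_gt0.
rewrite cfracE //.
have -> : (cf_num a n)%:R / (cf_den a n)%:R * (cf_den a m)%:R
    - (cf_num a m)%:R = (-1) ^+ m * X%:R / (cf_den a n)%:R :> R.
  by rewrite mulrAC HX mulrDl mulfK ?gt_eqF // addrAC subrr add0r.
by rewrite !mulrA -expr2 sqrr_sign mul1r divr_ge0 ?ler0n.
Qed.

Lemma cf_den_ge (a : nat -> nat) (n : nat) :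
  (forall i, (0 < a i.+1)%N) -> (n <= cf_den a n)%N.
Proof.
move=> a_gt0; elim/ltn_ind: n => -[|[|n]] IHn //; first exact: cf_den_gt0.
have [_ ->] := cf_recurrence a n.
have := IHn n.+1 (ltnSn _); have := a_gt0 n.+1; have := cf_den_gt0 n a_gt0.
by nia.
Qed.

(** A convergent [p_k / q_k] of even index lies below [alpha], and the determinant identity gives
    [alpha * q_k - p_k < 1 / q_(k+1)]. *)
Lemma small_excess (R : realType) (alpha : R) (a : nat -> nat) (eps : R) :
  (forall i, (0 < a i.+1)%N) -> irrational alpha -> has_cfrac alpha a ->
  0 < eps -> exists b c : nat, 0 < alpha * b%:R - c%:R < eps.
Proof.
move=> a_gt0 alpha_irr alpha_cf eps_gt0.
pose K := Num.Def.archi_bound eps^-1.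
have [k even_k le_Kk] : exists2 k, ~~ odd k & (K <= k.+1)%N.
  by exists K.*2; rewrite ?odd_double //; lia.
exists (cf_den a k), (cf_num a k).
have := cf_side k a_gt0 alpha_irr alpha_cf.
have := cf_side k.+1 a_gt0 alpha_irr alpha_cf.
have := natr_cf_det R a k.
rewrite exprS -signr_odd (negPf even_k) expr0 mulr1 mulN1r mul1r => det side1 side0.
have eps_k : eps^-1 < (cf_den a k.+1)%:R.
  have inv_ge0 : 0 <= eps^-1 by rewrite invr_ge0 ltW.
  apply: lt_le_trans (archi_boundP inv_ge0) _; rewrite ler_nat.
  exact: leq_trans (cf_den_ge _ a_gt0).
have den0 : 0 < (cf_den a k)%:R :> R by rewrite ltr0n cf_den_gt0.
have den1 : 0 < (cf_den a k.+1)%:R :> R by rewrite ltr0n cf_den_gt0.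
apply/andP; split=> //; rewrite -(ltr_pM2r den1).
have : 1 < eps * (cf_den a k.+1)%:R by rewrite mulrC -ltr_pdivrMr // mul1r.
move: det (mulr_gt0 den0 side1).
move: (cf_num a k.+1) (cf_den a k.+1) (cf_num a k) (cf_den a k) => N1 D1 N0 D0.
by lra.
Qed.

End Approximation.

(** * Factors of a Sturmian word, described through heights *)

Section Factors.
Local Open Scope ring_scope.

Definition ones (u : nat -> bool) (j : nat) : nat := (\sum_(t < j) u t)%N.

Lemma ones0 (u : nat -> bool) : ones u 0 = 0%N.
Proof. by rewrite /ones big_ord0. Qed.

Lemma onesS (u : nat -> bool) (j : nat) : ones u j.+1 = (ones u j + u j)%N.
Proof. by rewrite /ones big_ord_recr. Qed.

Lemma ones_shift (u : nat -> bool) (i j : nat) :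
  ones u (i + j) = (ones u i + ones (fun t => u (i + t)%N) j)%N.
Proof.
elim: j => [|j IHj]; first by rewrite addn0 ones0 addn0.
by rewrite addnS !onesS IHj addnA.
Qed.

Lemma eq_ones (u v : nat -> bool) (n : nat) :
  (forall j, (j < n)%N -> u j = v j) -> forall j, (j <= n)%N -> ones u j = ones v j.
Proof. by move=> uv j le_jn; apply: eq_bigr => i _; rewrite uv // (leq_trans (ltn_ord i)). Qed.

Lemma ones_inj (u v : nat -> bool) (n : nat) :
  (forall j, (j <= n)%N -> ones u j = ones v j) -> forall j, (j < n)%N -> u j = v j.
Proof.
move=> uv j lt_jn; have := uv j.+1 lt_jn; rewrite !onesS uv; last exact: ltnW.
by move/addnI; case: (u j) (v j) => [] [].
Qed.

Lemma ones_sturmian (R : realType) (alpha rho : R) (s : nat -> bool) (i j : nat) :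
  (forall n : nat, (s n)%:Z =
     Num.floor (alpha * n.+1%:R + rho) - Num.floor (alpha * n%:R + rho)) ->
  (ones (fun t => s (i + t)%N) j)%:Z =
  Num.floor (alpha * j%:R + (alpha * i%:R + rho)) - Num.floor (alpha * i%:R + rho).
Proof.
move=> sE; elim: j => [|j IHj]; first by rewrite ones0 mulr0 add0r subrr.
have shiftE k : alpha * k%:R + (alpha * i%:R + rho) = alpha * (i + k)%:R + rho.
  by rewrite natrD; ring.
by rewrite onesS PoszD IHj sE !shiftE addnS; ring.
Qed.

(** Walking up in steps [eta < delta] from [rho - M], which lies below [x], the first point beyond
    [x] lands in the window. *)
Lemma orbit_dense (R : realType) (alpha rho x delta : R) :
  (forall eps : R, 0 < eps -> exists b c : nat, 0 < alpha * b%:R - c%:R < eps) ->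
  0 < delta ->
  exists (i : nat) (N : int), x <= alpha * i%:R + rho + N%:~R < x + delta.
Proof.
move=> small delta_gt0; have [b [c /andP[eta_gt0 eta_lt]]] := small _ delta_gt0.
set eta := alpha * b%:R - c%:R in eta_gt0 eta_lt.
pose M := Num.Def.archi_bound `|rho - x|.
have rhoM : rho - x < M%:R.
  by apply: le_lt_trans (ler_norm _) _; exact: archi_boundP.
pose z := (x + M%:R - rho) / eta.
have z_ge0 : 0 <= z by rewrite divr_ge0 ?(ltW eta_gt0) //; lra.
have /andP[m_le m_gt] := truncn_itv z_ge0.
set m := Num.truncn z in m_le m_gt.
exists (m.+1 * b)%N, (- (M + m.+1 * c)%:Z).
have -> : alpha * (m.+1 * b)%:R + rho + (- (M + m.+1 * c)%:Z)%:~R =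
    m.+1%:R * eta + rho - M%:R :> R.
  by rewrite mulrNz -pmulrn natrD !natrM /eta; ring.
have zE : z * eta = x + M%:R - rho by rewrite divfK // gt_eqF.
have : m%:R * eta <= z * eta by rewrite ler_pM2r.
have : z * eta < m.+1%:R * eta by rewrite ltr_pM2r.
by rewrite zE -natr1; lra.
Qed.

(** The floor is continuous from the right: the [n + 1] points can be raised together by less than
    [delta] without reaching their next integers. This is why [orbit_dense] supplies a point at or
    above [x]. *)
Lemma floor_margin (R : realType) (alpha x : R) (n : nat) :
  exists2 delta : R, 0 < delta &
  forall j, (j <= n)%N ->
    alpha * j%:R + x + delta <= (Num.floor (alpha * j%:R + x) + 1)%:~R.
Proof.
elim: n => [|n [delta delta_gt0 IHn]].
  exists ((Num.floor (alpha * 0%:R + x) + 1)%:~R - (alpha * 0%:R + x)).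
    by rewrite subr_gt0 floorD1_gt.
  by move=> j; rewrite leqn0 => /eqP->; lra.
pose e := (Num.floor (alpha * n.+1%:R + x) + 1)%:~R - (alpha * n.+1%:R + x).
exists (Num.min delta e).
  by rewrite lt_min delta_gt0 subr_gt0 floorD1_gt.
move=> j; rewrite leq_eqVlt ltnS => /orP[/eqP->|/IHn].
  have : Num.min delta e <= e by rewrite ge_min lexx orbT.
  by rewrite /e; lra.
have : Num.min delta e <= delta by rewrite ge_min lexx.
by lra.
Qed.

(** A factor starting at [i] has intercept [alpha * i + rho]. Conversely, an orbit point slightly
    above [x] modulo 1 gives the same floor differences for all [j <= n]. *)
Lemma sturmian_factorP (R : realType) (alpha : R) (s u : nat -> bool) (n : nat) :
  (forall eps : R, 0 < eps -> exists b c : nat, 0 < alpha * b%:R - c%:R < eps) ->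
  Sturmian_word alpha s ->
  (exists i, forall j, (j < n)%N -> u j = s (i + j)%N) <->
  (exists x : R, forall j, (j <= n)%N ->
     (ones u j)%:Z = Num.floor (alpha * j%:R + x) - Num.floor x).
Proof.
move=> small [rho sE]; split=> [[i ui]|[x ux]].
  exists (alpha * i%:R + rho) => j le_jn.
  by rewrite (eq_ones ui) // (ones_sturmian _ _ sE).
have [delta delta_gt0 margin] := floor_margin alpha x n.
have [i [N /andP[xN Nx]]] := orbit_dense rho x small delta_gt0.
exists i; apply: ones_inj => j le_jn; apply/eqP; rewrite -eqz_nat; apply/eqP.
have floorE k : (k <= n)%N -> Num.floor (alpha * k%:R + (alpha * i%:R + rho)) =
    Num.floor (alpha * k%:R + x) - N.
  move=> le_kn; have := margin _ le_kn; have := floor_le (alpha * k%:R + x).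
  set f := Num.floor (alpha * k%:R + x) => f_le f_ge.
  by apply: floor_def; move: f_ge; rewrite !intrD !intrN; lra.
rewrite ux // (ones_sturmian _ _ sE) floorE //.
have := floorE 0%N isT; rewrite mulr0 !add0r => ->.
by rewrite opprB addrA subrK.
Qed.

End Factors.

(** * Periodic words whose windows are all factors, and Farey adjacency *)

Section Adjacency.
Local Open Scope ring_scope.

(* No fraction of denominator at most [n] lies strictly between [p / n] and
   [alpha], that is, [p / n] is a Farey neighbour of [alpha] of order [n]. *)
Definition farey_adjacent (R : realType) (alpha : R) (p n : nat) : Prop :=
  forall j N : nat, (0 < j <= n)%N ->
    ~ ((p * j < N * n)%N /\ N%:R < alpha * j%:R) /\
    ~ ((N * n < p * j)%N /\ alpha * j%:R < N%:R).

Lemma quasi_periodic_mod (H : nat -> nat) (n p i : nat) :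
  (forall i, H (i + n) = H i + p)%N -> (H i = H (i %% n) + p * (i %/ n))%N.
Proof.
move=> Hn; rewrite {1}(divn_eq i n); elim: (i %/ n)%N => [|m IHm].
  by rewrite mul0n muln0 addn0 add0n.
by rewrite mulSn -addnA addnC Hn IHm mulnS addnAC addnA.
Qed.

Lemma sum_quasi_periodic_shift (H : nat -> nat) (n p j : nat) :
  (forall i, H (i + n) = H i + p)%N ->
  (\sum_(k < n) H (k + j) = \sum_(k < n) H k + p * j)%N.
Proof.
move=> Hn; elim: j => [|j IHj].
  by rewrite muln0 addn0; apply: eq_bigr => k _; rewrite addn0.
have : (\sum_(k < n.+1) H (k + j) = \sum_(k < n.+1) H (k + j))%N by [].
rewrite [LHS]big_ord_recl [RHS]big_ord_recr /= add0n IHj (addnC n) Hn.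
under eq_bigr => k _ do rewrite /bump /= add1n addSnnS.
by rewrite addnCA => /addnI ->; rewrite mulnSr addnA.
Qed.

(** [H] stands for the heights of a periodic word with [p] ones per period [n], all of whose windows
    of length [n] are factors. *)
Lemma balanced_quasi_periodic (R : realType) (alpha : R) (H : nat -> nat)
    (n p : nat) :
  irrational alpha -> 0 < alpha -> (0 < n)%N ->
  (forall i, H (i + n) = H i + p)%N ->
  (forall k, (k < n)%N -> exists x : R, forall j, (j <= n)%N ->
     (H (k + j)%N)%:Z - (H k)%:Z = Num.floor (alpha * j%:R + x) - Num.floor x) ->
  farey_adjacent alpha p n /\
  exists2 j0, (j0 < n)%N &
    forall j, (j <= n)%N -> (H (j0 + j) = H j0 + (p * j) %/ n)%N.
Proof.
move=> alpha_irr alpha_gt0 n_gt0 Hn Hfloor.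
(* From every start, [j] letters contain [f] or [f + 1] ones, where [f] is the floor of [alpha * j];
   irrationality keeps [alpha * j] off the integers. *)
have step j : (0 < j <= n)%N -> exists f : nat,
    f%:R < alpha * j%:R < f.+1%:R /\
    forall k, (k < n)%N -> (H k + f <= H (k + j) <= H k + f.+1)%N.
  move=> /andP[j_gt0 le_jn]; exists (Num.truncn (alpha * j%:R)).
  have aj_ge0 : 0 <= alpha * j%:R by rewrite mulr_ge0 ?ler0n ?ltW.
  have := truncn_itv aj_ge0; set f := Num.truncn _ => /andP[f_le f_gt].
  have f_lt : f%:R < alpha * j%:R.
    by rewrite lt_neqAle f_le eq_sym irrational_neq_natr.
  split; first by rewrite f_lt f_gt.
  move=> k lt_kn; have [x /(_ _ le_jn)] := Hfloor k lt_kn.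
  have := floor_le x; have := floorD1_gt x.
  have := floor_le (alpha * j%:R + x); have := floorD1_gt (alpha * j%:R + x).
  set g := Num.floor (_ + x); set h := Num.floor x; rewrite !intrD.
  move=> g_gt g_le h_gt h_le Hgh.
  have gh_lt : (g - h)%:~R < (f.+2)%:~R :> R.
    by rewrite intrB -pmulrn -!natr1; move: f_gt; rewrite -natr1; lra.
  have gh_gt : f%:R - 1 < (g - h)%:~R :> R by rewrite intrB; lra.
  have gh_gtz : (f%:Z - 1)%:~R < (g - h)%:~R :> R.
    by rewrite [X in X < _]intrB -pmulrn.
  move: gh_lt gh_gtz; rewrite !ltr_int -Hgh; lia.
(* The increments over the [n] starts sum to [p * j]; a single start with increment exactly [f]
   makes the upper bound strict. *)
have bounds j f : (j <= n)%N ->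
    (forall k, (k < n)%N -> (H k + f <= H (k + j) <= H k + f.+1)%N) ->
    [/\ (f * n <= p * j)%N, (p * j <= f.+1 * n)%N &
     forall k, (k < n)%N -> H (k + j)%N = (H k + f)%N -> (p * j < f.+1 * n)%N].
  move=> le_jn Hf; have := sum_quasi_periodic_shift j Hn.
  have sumE c : (\sum_(k < n) (H k + c) = \sum_(k < n) H k + c * n)%N.
    by rewrite big_split /= sum_nat_const card_ord mulnC.
  move=> sum_j; split.
  - rewrite -(leq_add2l (\sum_(k < n) H k)) -sumE -sum_j leq_sum // => k _.
    by have /andP[] := Hf k (ltn_ord k).
  - rewrite -(leq_add2l (\sum_(k < n) H k)) -sumE -sum_j leq_sum // => k _.
    by have /andP[] := Hf k (ltn_ord k).
  move=> k lt_kn Hk; rewrite -(ltn_add2l (\sum_(k < n) H k)) -sumE -sum_j.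
  rewrite (bigD1 (Ordinal lt_kn)) //= [ltnRHS](bigD1 (Ordinal lt_kn)) //=.
  rewrite Hk addnS addSn ltnS leq_add2l leq_sum // => i _.
  by have /andP[] := Hf i (ltn_ord i).
split.
  (* Both [p * j / n] and [alpha * j] lie in [[f, f + 1]], so no integer [N] separates them
     strictly. *)
  move=> j N j_bnd; have [f [/andP[f_lt f_gt] Hf]] := step j j_bnd.
  have /andP[_ le_jn] := j_bnd.
  have [lo hi _] := bounds j f le_jn Hf.
  split=> -[pN aN].
    have : (N%:R : R) < f.+1%:R by apply: lt_trans aN f_gt.
    by rewrite ltr_nat ltnS => le_Nf; have := leq_mul2r n N f; lia.
  have : (f%:R : R) < N%:R by apply: lt_trans f_lt aN.
  by rewrite ltr_nat => lt_fN; have := leq_mul2r n f.+1 N; lia.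
(* [G] is [n] times the height above the line of slope [p / n]. It has period [n], so its maximum
   over one period is global, and the path stays on or below the parallel line through that
   point. *)
pose G (i : nat) : int := (n * H i)%:Z - (p * i)%:Z.
case: (@arg_maxP _ _ _ (Ordinal n_gt0) xpredT (fun i : 'I_n => G i)) => // j0 _ G_max.
exists (j0 : nat) => // j le_jn.
have G_le i : G i <= G j0.
  have lt_in : (i %% n < n)%N by rewrite ltn_mod.
  have pE : (p * i = n * (p * (i %/ n)) + p * (i %% n))%N.
    by rewrite [in LHS](divn_eq i n); ring.
  have := G_max (Ordinal lt_in) isT; rewrite /G /= (quasi_periodic_mod i Hn) pE.
  by rewrite mulnDr; lia.
have [->|j_gt0] := posnP j; first by rewrite muln0 div0n !addn0.
have j_bnd : (0 < j <= n)%N by rewrite j_gt0.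
have [f [_ Hf]] := step j j_bnd.
have [lo hi strict] := bounds j f le_jn Hf.
have := Hf j0 (ltn_ord j0); have := strict j0 (ltn_ord j0).
have := G_le (j0 + j)%N; rewrite /G => G_j strict_j Hf_j.
have [D HD] : exists D, H (j0 + j)%N = (H j0 + D)%N.
  by exists (H (j0 + j) - H j0)%N; lia.
rewrite HD in G_j strict_j Hf_j *; congr addn.
(* If [D = f], the strict average bound gives [p * j < (D + 1) * n]; if [D = f + 1], maximality at
   [j0] gives [D * n <= p * j]. The averages give the other bound. *)
have Df : D = f \/ D = f.+1 by lia.
have leD : (D * n <= p * j)%N by nia.
have ltD : (p * j < D.+1 * n)%N by case: Df strict_j => ->; nia.
by apply/eqP; rewrite eqn_leq leq_divRL // leD -ltnS ltn_divLR // ltD.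
Qed.

(** Increments of [F] over [t] steps differ from [alpha * t] by less than 1, so the deviations [A]
    vary by less than 1, and their maximum serves as intercept [x]. *)
Lemma adjacent_quasi_periodic (R : realType) (alpha : R) (n p k : nat) :
  irrational alpha -> 0 < alpha -> (0 < n)%N ->
  farey_adjacent alpha p n ->
  exists x : R, forall j, (j <= n)%N ->
    ((p * (k + j)) %/ n)%:Z - ((p * k) %/ n)%:Z =
    Num.floor (alpha * j%:R + x) - Num.floor x.
Proof.
move=> alpha_irr alpha_gt0 n_gt0 adj.
pose F j := ((p * j) %/ n)%N.
have F_bnd m t : (t <= n)%N ->
    alpha * t%:R - 1 < (F (m + t)%N)%:R - (F m)%:R < alpha * t%:R + 1.
  have [-> _|t_gt0 le_tn] := posnP t; first by rewrite addn0; lra.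
  have le_F : (F m <= F (m + t))%N by rewrite leq_div2r // leq_mul2l leq_addr orbT.
  rewrite -natrB //; set D := (F (m + t) - F m)%N.
  have E1 := divn_eq (p * m) n; have E2 := divn_eq (p * (m + t)) n.
  have L1 := ltn_pmod (p * m) n_gt0; have L2 := ltn_pmod (p * (m + t)) n_gt0.
  have FD : F (m + t)%N = (F m + D)%N by rewrite /D; lia.
  rewrite -/(F m) in E1; rewrite -/(F (m + t)) FD in E2.
  have t_bnd : (0 < t <= n)%N by rewrite t_gt0.
  (* The floors give [D - 1 < p * t / n < D + 1]; adjacency carries both inequalities over to
     [alpha * t]. *)
  have [no_gt _] := adj t D.+1 t_bnd.
  have [_ no_lt] := adj t D.-1 t_bnd.
  have ltD : alpha * t%:R <= D.+1%:R.
    by rewrite leNgt; apply/negP => aD; apply: no_gt; split=> //; nia.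
  have ltD' : alpha * t%:R < D.+1%:R by rewrite lt_neqAle ltD irrational_neq_natr.
  have at_gt0 : 0 < alpha * t%:R by rewrite mulr_gt0 ?ltr0n.
  apply/andP; split; first by move: ltD'; rewrite -natr1; lra.
  (* [D = 0] is treated apart because [D.-1] would then be 0 instead of -1. *)
  have [->|D_gt0] := posnP D; first by lra.
  have leD : D.-1%:R <= alpha * t%:R.
    rewrite leNgt; apply/negP => aD; apply: no_lt; split=> //.
    by have := prednK D_gt0; nia.
  have leD' : D.-1%:R < alpha * t%:R.
    by rewrite lt_neqAle leD eq_sym irrational_neq_natr.
  by move: leD'; rewrite -[in X in _ -> X](prednK D_gt0) -natr1; lra.
pose A (i : nat) : R := (F (k + i)%N)%:R - (F k)%:R - alpha * i%:R.
have A_lt i j : (i <= n)%N -> (j <= n)%N -> A i < A j + 1.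
  move=> le_in le_jn; rewrite /A; have [le_ij|lt_ji] := leqP i j.
    have := @F_bnd (k + i)%N (j - i)%N; rewrite -addnA subnKC // natrB //.
    by move=> /(_ (leq_trans (leq_subr _ _) le_jn)); lra.
  have le_ji := ltnW lt_ji.
  have := @F_bnd (k + j)%N (i - j)%N; rewrite -addnA subnKC // natrB //.
  by move=> /(_ (leq_trans (leq_subr _ _) le_in)); lra.
case: (@arg_maxP _ _ _ (ord0 : 'I_n.+1) xpredT (fun i => A i)) => // i0 _ A_max.
have le_A j : (j <= n)%N -> A j <= A i0.
  by move=> le_jn; apply: (A_max (Ordinal (le_jn : (j < n.+1)%N))).
exists (A i0).
have floorE j : (j <= n)%N ->
    Num.floor (alpha * j%:R + A i0) = (F (k + j)%N)%:Z - (F k)%:Z.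
  move=> le_jn; apply: floor_def; rewrite !intrD intrN -!pmulrn.
  have := le_A j le_jn; have := A_lt i0 j (leq_ord i0) le_jn.
  have -> : A j = (F (k + j)%N)%:R - (F k)%:R - alpha * j%:R by [].
  by move: (A i0) => x; lra.
move=> j le_jn; rewrite floorE //; have := floorE 0%N isT.
by rewrite mulr0 add0r addn0 subrr => ->; rewrite subr0.
Qed.

End Adjacency.

(** * Periodic extensions, rotations and mechanical words *)

Section Words.
Local Open Scope nat_scope.

(** This is [w^oo]; the default [false] is reached only for empty [w]. *)
Definition cyclic_ext (w : seq bool) (t : nat) : bool := nth false w (t %% size w).

Lemma nth_rot_cyclic_ext (w : seq bool) (k j : nat) :
  k <= size w -> j < size w -> nth false (rot k w) j = cyclic_ext w (k + j).
Proof.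
move=> le_k lt_j; rewrite /rot /cyclic_ext nth_cat size_drop nth_drop.
have [lt_kj|le_kj] := ltnP j (size w - k); first by rewrite modn_small //; lia.
rewrite nth_take; last by lia.
have -> : k + j = (j - (size w - k)) + size w by lia.
by rewrite modnDr modn_small //; lia.
Qed.

Lemma ones_cyclic_ext_period (w : seq bool) (i : nat) :
  ones (cyclic_ext w) (i + size w) =
  ones (cyclic_ext w) i + ones (cyclic_ext w) (size w).
Proof.
rewrite addnC ones_shift addnC; congr addn; apply: eq_bigr => t _.
by rewrite /cyclic_ext modnDl.
Qed.

Lemma factor_nth (s : nat -> bool) (w : seq bool) :
  Defs.factor s w <-> exists i, forall j, j < size w -> nth false w j = s (i + j).
Proof.
split=> [[i wE]|[i wE]]; exists i.
  by move=> j lt_j; rewrite wE nth_mkseq.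
by apply: (@eq_from_nth _ false) => [|j lt_j]; rewrite ?size_mkseq // nth_mkseq ?wE.
Qed.

Lemma factor_rotP (R : realType) (alpha : R) (s : nat -> bool) (w : seq bool)
    (k : nat) :
  (forall eps : R, (0 < eps)%R ->
     exists b c : nat, (0 < alpha * b%:R - c%:R < eps)%R) ->
  Sturmian_word alpha s -> k <= size w ->
  Defs.factor s (rot k w) <->
  exists x : R, forall j, j <= size w ->
    ((ones (cyclic_ext w) (k + j))%:Z - (ones (cyclic_ext w) k)%:Z =
     Num.floor (alpha * j%:R + x) - Num.floor x)%R.
Proof.
move=> small s_sturm le_k; rewrite factor_nth size_rot.
have := sturmian_factorP (fun t => cyclic_ext w (k + t)) (size w) small s_sturm.
have onesE j : ((ones (cyclic_ext w) (k + j))%:Z - (ones (cyclic_ext w) k)%:Z =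
    (ones (fun t => cyclic_ext w (k + t)) j)%:Z)%R.
  by rewrite ones_shift PoszD addrAC subrr add0r.
move=> factP; split=> [[i wE]|[x xE]].
  have [|x xE] := factP.1; last by exists x => j le_j; rewrite onesE xE.
  by exists i => j lt_j; rewrite -nth_rot_cyclic_ext // wE.
have [|i wE] := factP.2; first by exists x => j le_j; rewrite -onesE xE.
by exists i => j lt_j; rewrite nth_rot_cyclic_ext // wE.
Qed.

(* The lower Christoffel word of slope [p / n], or a power of it when [p] and
   [n] are not coprime. *)
Definition mechanical (n p : nat) : n.-tuple bool :=
  mktuple (fun j : 'I_n => (p * j) %/ n != (p * j.+1) %/ n).

(** Since [p <= n], consecutive floors differ by 0 or 1, so the test in [mechanical] records the
    full increment; a period adds exactly [p], which extends the formula to all [j]. *)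
Lemma ones_mechanical (n p j : nat) : 0 < n -> p <= n ->
  ones (cyclic_ext (mechanical n p)) j = (p * j) %/ n.
Proof.
move=> n_gt0 le_pn; elim: j => [|j IHj]; first by rewrite ones0 muln0 div0n.
have lt_jn : j %% n < n by rewrite ltn_mod.
rewrite onesS IHj /cyclic_ext size_tuple -[X in nth _ _ X]/(nat_of_ord (Ordinal lt_jn)).
rewrite -tnth_nth tnth_mktuple /=.
have shiftE i : (p * (j %/ n * n + i)) %/ n = p * (j %/ n) + (p * i) %/ n.
  by rewrite mulnDr mulnA divnMDl.
rewrite [in RHS](divn_eq j n) {1}(divn_eq j n) -addnS !shiftE.
set i := j %% n; rewrite mulnS.
have := divn_eq (p * i) n; have := divn_eq (p + p * i) n.
have := ltn_pmod (p * i) n_gt0; have := ltn_pmod (p + p * i) n_gt0.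
set a := (p * i) %/ n; set b := (p + p * i) %/ n => lt1 lt2 E1 E2.
have ab : b = a \/ b = a.+1 by nia.
by case: ab => ->; rewrite ?eqxx ?addn0 // neq_ltn ltnSn /=; lia.
Qed.

Lemma ones_cyclic_ext_size (w : seq bool) :
  ones (cyclic_ext w) (size w) = count id w.
Proof.
rewrite -sumn_count sumnE big_map (big_nth false) big_mkord.
by apply: eq_bigr => i _; rewrite /cyclic_ext modn_small.
Qed.

Lemma eq_word_ones (v w : seq bool) :
  size v = size w ->
  (forall j, j <= size w -> ones (cyclic_ext v) j = ones (cyclic_ext w) j) ->
  v = w.
Proof.
move=> size_vw vw; apply: (@eq_from_nth _ false) => // j; rewrite size_vw => lt_j.
by have := ones_inj vw lt_j; rewrite /cyclic_ext size_vw modn_small.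
Qed.

Lemma ones_cyclic_ext_rot (w : seq bool) (k j : nat) :
  k <= size w -> j <= size w ->
  ones (cyclic_ext w) (k + j) =
  ones (cyclic_ext w) k + ones (cyclic_ext (rot k w)) j.
Proof.
move=> le_k le_j; rewrite ones_shift; congr addn.
apply: (eq_ones _ le_j) => t lt_t.
by rewrite -nth_rot_cyclic_ext // /cyclic_ext size_rot modn_small.
Qed.

End Words.

(** * Conjugacy classes counted by adjacent numerators *)

Section Classes.
Local Open Scope nat_scope.

Lemma conj_classP (A : finType) (n : nat) (v w : n.-tuple A) :
  reflect (exists2 k, k <= n & tval v = rot k w) (v \in conj_class w).
Proof.
rewrite inE; apply: (iffP existsP) => [[k /eqP->]|[k le_kn ->]].
  by exists (k : nat); rewrite // -ltnS.
by exists (Ordinal (le_kn : k < n.+1)).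
Qed.

Lemma conj_class_sub (A : finType) (n : nat) (v w : n.-tuple A) :
  v \in conj_class w -> conj_class v \subset conj_class w.
Proof.
move=> /conj_classP[k le_kn vE]; apply/fintype.subsetP => u /conj_classP[i le_in uE].
apply/conj_classP; rewrite uE vE rot_add_mod ?size_tuple //.
by exists (if i + k <= n then i + k else i + k - n) => //; case: ifP; lia.
Qed.

Lemma conj_class_sym (A : finType) (n : nat) (v w : n.-tuple A) :
  v \in conj_class w -> w \in conj_class v.
Proof.
move=> /conj_classP[k le_kn vE]; apply/conj_classP; exists (n - k).
  exact: leq_subr.
by rewrite vE -{1}(rotK k w) /rotr size_rot size_tuple.
Qed.

Lemma conj_class_eq (A : finType) (n : nat) (v w : n.-tuple A) :
  v \in conj_class w -> conj_class v = conj_class w.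
Proof.
move=> vw; apply/eqP; rewrite finset.eqEsubset conj_class_sub //=.
by apply: conj_class_sub; exact: conj_class_sym.
Qed.

Lemma conj_class_refl (A : finType) (n : nat) (w : n.-tuple A) :
  w \in conj_class w.
Proof. by apply/conj_classP; exists 0; rewrite ?rot0. Qed.

(** Sending [p] to the class of [mechanical n p] is a bijection from the adjacent numerators onto
    the counted classes; [p] is the number of ones, hence at most [n]. *)
Lemma Lie_complexity_farey (R : realType) (alpha : R) (s : nat -> bool) (n : nat) :
  (forall eps : R, (0 < eps)%R ->
     exists b c : nat, (0 < alpha * b%:R - c%:R < eps)%R) ->
  irrational alpha -> (0 < alpha)%R -> Sturmian_word alpha s -> 0 < n ->
  Lie_complexity s n = #|[set p : 'I_n.+1 | `[< farey_adjacent alpha p n >]]%SET|.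
Proof.
move=> small alpha_irr alpha_gt0 s_sturm n_gt0.
(* Rotation preserves the number of ones, which recovers [p]. *)
have class_inj : injective (fun p : 'I_n.+1 => conj_class (mechanical n p)).
  move=> p r /= pr; have := conj_class_refl (mechanical n p).
  rewrite pr => /conj_classP[k _ /(congr1 (count id))].
  rewrite (permP (permEl (perm_rot _ _))) -!ones_cyclic_ext_size !size_tuple.
  by rewrite !ones_mechanical ?mulnK ?leq_ord // => /val_inj.
rewrite -(card_imset _ class_inj); apply: eq_card => C; rewrite inE.
apply/andP/imsetP => [[/imsetP[w _ ->] /forall_inP allw]|[p]].
  pose H := ones (cyclic_ext w); pose p := H n.
  have Hn i : H (i + n) = H i + p.
    by have := ones_cyclic_ext_period w i; rewrite size_tuple.
  have Hfloor k : k < n -> exists x : R, forall j, j <= n ->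
      ((H (k + j)%N)%:Z - (H k)%:Z = Num.floor (alpha * j%:R + x) - Num.floor x)%R.
    move=> lt_kn; have le_k : k <= size w by rewrite size_tuple ltnW.
    have /asboolP : `[< Defs.factor s (rot_tuple k w) >].
      by apply: allw; apply/conj_classP; exists k; rewrite ?(ltnW lt_kn).
    by move=> /(factor_rotP small s_sturm le_k); rewrite size_tuple.
  have [adj [j0 lt_j0 HE]] :=
    balanced_quasi_periodic alpha_irr alpha_gt0 n_gt0 Hn Hfloor.
  have le_pn : p < n.+1.
    rewrite ltnS /p /H -[X in ones _ X](size_tuple w) ones_cyclic_ext_size.
    by rewrite -[X in _ <= X](size_tuple w) count_size.
  exists (Ordinal le_pn); first by rewrite inE; apply/asboolP.
  (* The rotation of [w] by [j0] has the heights of [mechanical n p], and heights determine the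
     word. *)
  apply/esym/conj_class_eq/conj_classP; exists j0; first exact: ltnW.
  apply: eq_word_ones => [|j]; first by rewrite size_rot !size_tuple.
  rewrite size_rot size_tuple => le_jn; rewrite ones_mechanical //=.
  apply/(@addnI (H j0)); rewrite -HE // /H ones_cyclic_ext_rot ?size_tuple //.
  exact: ltnW.
rewrite inE => /asboolP adj ->; split; first exact: imset_f.
apply/forall_inP => v /conj_classP[k le_kn ->]; apply/asboolP.
apply/(factor_rotP small s_sturm); rewrite size_tuple //.
have [x xE] := adjacent_quasi_periodic k alpha_irr alpha_gt0 n_gt0 adj.
exists x => j le_jn; rewrite !ones_mechanical ?leq_ord //.
exact: xE.
Qed.

End Classes.

(** * Farey neighbours of [alpha] *)

Section FareyNeighbours.
Local Open Scope ring_scope.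

(** The determinant gives [j = (N * b - a * j) * b' + (a' * j - N * b') * b], with both
    parenthesised factors at least 1. *)
Lemma farey_gap (a b a' b' N j : nat) :
  (a' * b = a * b' + 1)%N -> (a * j < N * b)%N -> (N * b' < a' * j)%N ->
  (b + b' <= j)%N.
Proof.
move=> det aN Na.
have [x Ex] : exists x, (N * b = a * j + x.+1)%N by exists (N * b - a * j).-1; lia.
have [y Ey] : exists y, (a' * j = N * b' + y.+1)%N.
  by exists (a' * j - N * b').-1; lia.
have : (a' * b * j = a * b' * j + j)%N by rewrite det mulnDl mul1n.
have -> : (a' * b * j = (a' * j) * b)%N by ring.
have -> : (a * b' * j = (a * j) * b')%N by ring.
have : ((N * b) * b' = (a * j + x.+1) * b')%N by rewrite Ex.
by rewrite Ey !mulnDl; nia.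
Qed.

(** Since [n < b + b'], [farey_gap] leaves no fraction of denominator at most [n] strictly between
    [a / b] and [a' / b'], while a fraction beyond an endpoint is separated from [alpha] by that
    endpoint. *)
Lemma farey_adjacentP (R : realType) (alpha : R) (a b a' b' n p : nat) :
  irrational alpha -> a%:R < alpha * b%:R -> alpha * b'%:R < a'%:R ->
  (a' * b = a * b' + 1)%N -> (0 < b <= n)%N -> (0 < b' <= n)%N ->
  (n < b + b')%N ->
  farey_adjacent alpha p n <-> (p * b = a * n)%N \/ (p * b' = a' * n)%N.
Proof.
move=> alpha_irr lo hi det b_bnd b'_bnd lt_n.
have /andP[b_gt0 le_bn] := b_bnd; have /andP[b'_gt0 le_b'n] := b'_bnd.
have n_gt0 : (0 < n)%N by lia.
have lt_b'R x y : x%:R < alpha * y%:R -> (0 < y)%N -> (x * b' < a' * y)%N.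
  move=> xy y_gt0; rewrite -(ltr_nat R) !natrM.
  have b'R : 0 < b'%:R :> R by rewrite ltr0n.
  have yR : 0 < y%:R :> R by rewrite ltr0n.
  have : x%:R * b'%:R < alpha * y%:R * b'%:R by rewrite ltr_pM2r.
  have : alpha * b'%:R * y%:R < a'%:R * y%:R by rewrite ltr_pM2r.
  by lra.
have lt_bR x y : alpha * y%:R < x%:R -> (0 < y)%N -> (a * y < x * b)%N.
  move=> xy y_gt0; rewrite -(ltr_nat R) !natrM.
  have bR : 0 < b%:R :> R by rewrite ltr0n.
  have yR : 0 < y%:R :> R by rewrite ltr0n.
  have : alpha * y%:R * b%:R < x%:R * b%:R by rewrite ltr_pM2r.
  have : a%:R * y%:R < alpha * b%:R * y%:R by rewrite ltr_pM2r.
  by lra.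
have far N j : (a * j < N * b)%N -> (N * b' < a' * j)%N -> (j <= n)%N -> False.
  by move=> aN Na le_jn; have := farey_gap det aN Na; lia.
(* A fraction [N / j] refuting adjacency fixes the side of [alpha] on which [p / n] lies. *)
have scaled N j : (p * j < N * n)%N -> N%:R < alpha * j%:R -> (0 < j)%N ->
    p%:R < alpha * n%:R.
  move=> pN Nj j_gt0; have jR : 0 < j%:R :> R by rewrite ltr0n.
  have nR : 0 < n%:R :> R by rewrite ltr0n.
  rewrite -(ltr_pM2r jR); move: pN; rewrite -(ltr_nat R) !natrM => pN.
  have : N%:R * n%:R < alpha * j%:R * n%:R by rewrite ltr_pM2r.
  by lra.
have scaled' N j : (N * n < p * j)%N -> alpha * j%:R < N%:R -> (0 < j)%N ->
    alpha * n%:R < p%:R.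
  move=> pN Nj j_gt0; have jR : 0 < j%:R :> R by rewrite ltr0n.
  have nR : 0 < n%:R :> R by rewrite ltr0n.
  rewrite -(ltr_pM2r jR); move: pN; rewrite -(ltr_nat R) !natrM => pN.
  have : alpha * j%:R * n%:R < N%:R * n%:R by rewrite ltr_pM2r.
  by lra.
split=> [adj|pE j N /andP[j_gt0 le_jn]].
  have : alpha * n%:R != p%:R by apply: irrational_neq_natr.
  rewrite neq_lt => /orP[p_gt|p_lt]; [right|left].
    have [_ no] := adj b' a' b'_bnd.
    have [lt_p|gt_p|//] := ltngtP (p * b')%N (a' * n)%N.
      by case: (far p n) => //; exact: lt_bR.
    by case: no.
  have [no _] := adj b a b_bnd.
  have [lt_p|gt_p|//] := ltngtP (p * b)%N (a * n)%N; first by case: no.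
  by case: (far p n) => //; exact: lt_b'R.
case: pE => pE.
  have lt_p : p%:R < alpha * n%:R.
    have bR : 0 < b%:R :> R by rewrite ltr0n.
    have nR : 0 < n%:R :> R by rewrite ltr0n.
    rewrite -(ltr_pM2r bR) -natrM pE natrM.
    have : a%:R * n%:R < alpha * b%:R * n%:R by rewrite ltr_pM2r.
    by lra.
  split=> -[pN Nj].
    apply: (far N j) => //; last exact: lt_b'R.
    rewrite -(ltn_pmul2r n_gt0) mulnAC -pE.
    by rewrite mulnAC (mulnAC N) ltn_pmul2r.
  by have := scaled' N j pN Nj j_gt0; lra.
have gt_p : alpha * n%:R < p%:R.
  have b'R : 0 < b'%:R :> R by rewrite ltr0n.
  have nR : 0 < n%:R :> R by rewrite ltr0n.
  rewrite -(ltr_pM2r b'R) -[ltRHS]natrM pE natrM.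
  have : alpha * b'%:R * n%:R < a'%:R * n%:R by rewrite ltr_pM2r.
  by lra.
split=> -[pN Nj]; first by have := scaled N j pN Nj j_gt0; lra.
apply: (far N j) => //; first exact: lt_bR.
rewrite -(ltn_pmul2r n_gt0) (mulnAC a') -pE.
by rewrite mulnAC (mulnAC p) ltn_pmul2r.
Qed.

(** If both [b] and [b'] divided [n], coprimality would give [b * b' <= n < b + b'], impossible with
    both at least 2. *)
Lemma card_farey_adjacent (R : realType) (alpha : R) (a b a' b' n : nat) :
  irrational alpha -> alpha <= 1 -> a%:R < alpha * b%:R -> alpha * b'%:R < a'%:R ->
  (a' * b = a * b' + 1)%N -> (1 < b <= n)%N -> (1 < b' <= n)%N ->
  (n < b + b')%N ->
  #|[set p : 'I_n.+1 | `[< farey_adjacent alpha p n >]]%SET| =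
  (b %| n)%N || (b' %| n)%N.
Proof.
move=> alpha_irr alpha_le1 lo hi det b_bnd b'_bnd lt_n.
have adjP p : farey_adjacent alpha p n <-> (p * b = a * n)%N \/ (p * b' = a' * n)%N.
  by apply: (farey_adjacentP _ alpha_irr lo hi) => //; lia.
have co_bb' : coprime b b'.
  by apply/coprimeP; [lia|exists (a', a) => /=; lia].
have co_ba : coprime b a.
  by apply/coprimeP; [lia|exists (a', b') => /=; lia].
have co_b'a' : coprime b' a'.
  rewrite coprime_sym; apply/coprimeP; first by nia.
  by exists (b, a) => /=; lia.
have dvd_b p : (p * b = a * n)%N -> (b %| n)%N.
  by move=> pE; rewrite -(Gauss_dvdr _ co_ba) -pE dvdn_mull.
have dvd_b' p : (p * b' = a' * n)%N -> (b' %| n)%N.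
  by move=> pE; rewrite -(Gauss_dvdr _ co_b'a') -pE dvdn_mull.
have not_both : (b %| n)%N -> (b' %| n)%N -> False.
  move=> bn b'n; have : (b * b' %| n)%N by rewrite Gauss_dvd // bn.
  by move/dvdn_leq => /(_ ltac:(lia)); nia.
(* [lt_ab] and [le_a'b'] ensure that a neighbour written with denominator [n] has its numerator in
   ['I_n.+1]. *)
have lt_ab : (a < b)%N.
  have bR : 0 < b%:R :> R by rewrite ltr0n; lia.
  by rewrite -(ltr_nat R) (lt_le_trans lo) // ger_pMl.
have le_a'b' : (a' <= b')%N.
  rewrite leqNgt; apply/negP => lt_b'a'.
  (* Otherwise [1 / 1] would lie strictly between the neighbours. *)
  by have := @farey_gap a b a' b' 1 1 det; nia.
have unique (p0 : nat) : (p0 <= n)%N ->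
    (forall p, farey_adjacent alpha p n <-> p = p0) ->
    #|[set p : 'I_n.+1 | `[< farey_adjacent alpha p n >]]%SET| = 1%N.
  move=> le_p0 p0P; rewrite -(cards1 (Ordinal (le_p0 : (p0 < n.+1)%N))).
  apply: eq_card => p; rewrite !inE; apply/asboolP/eqP => [/p0P pp0|->].
    exact: val_inj.
  exact/p0P.
case: (boolP (b %| n)%N) => [bn|nbn] /=.
  case/dvdnP: (bn) => m mE.
  apply: (@unique (a * m)%N) => [|p]; first by nia.
  rewrite adjP mE; split=> [[pE|pE]| ->]; last by left; ring.
    by apply/eqP; rewrite -(@eqn_pmul2r b) ?pE; [apply/eqP; ring|lia].
  by case: not_both => //; apply: (@dvd_b' p); rewrite pE -mE.
case: (boolP (b' %| n)%N) => [b'n|nb'n] /=.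
  case/dvdnP: (b'n) => m mE.
  apply: (@unique (a' * m)%N) => [|p]; first by nia.
  rewrite adjP mE; split=> [[pE|pE]| ->]; last by right; ring.
    by case/negP: nbn; apply: (@dvd_b p); rewrite pE -mE.
  by apply/eqP; rewrite -(@eqn_pmul2r b') ?pE; [apply/eqP; ring|lia].
apply/eqP; rewrite cards_eq0; apply/eqP/setP => p; rewrite !inE.
apply/negbTE/asboolPn => /adjP[/dvd_b|/dvd_b'] dvd; first by rewrite dvd in nbn.
by rewrite dvd in nb'n.
Qed.

End FareyNeighbours.

(** * Denominators of convergents and semiconvergents *)

Section Denominators.
Local Open Scope nat_scope.

Lemma cf_den_slope (d : nat -> nat) (k : nat) : cf_den (slope_quotients d) k = q d k.
Proof.
elim/ltn_ind: k => -[|[|k]] IHk //.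
by have [_ ->] := cf_recurrence (slope_quotients d) k; rewrite !IHk.
Qed.

Lemma slope_quotients_gt0 (d : nat -> nat) (i : nat) :
  (forall i, 1 <= i -> 1 <= d i) -> 0 < slope_quotients d i.+1.
Proof. by move=> d_pos; case: i => [|i] /=; [rewrite addn1|exact: d_pos]. Qed.

Lemma qSS (d : nat -> nat) (k : nat) : q d k.+2 = d k.+2 * q d k.+1 + q d k.
Proof. by []. Qed.

Lemma q_gt0 (d : nat -> nat) (k : nat) :
  (forall i, 1 <= i -> 1 <= d i) -> 0 < q d k.
Proof.
by move=> d_pos; rewrite -cf_den_slope cf_den_gt0 // => i; exact: slope_quotients_gt0.
Qed.

Lemma q_ltS (d : nat -> nat) (k : nat) :
  (forall i, 1 <= i -> 1 <= d i) -> q d k < q d k.+1.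
Proof.
move=> d_pos; case: k => [|k]; first by have := d_pos 1 isT; rewrite /=; lia.
rewrite qSS; have := d_pos k.+2 isT; have := q_gt0 k d_pos; nia.
Qed.

(** Take [k] least with [n < q_(k+2) + q_(k+1)], which forces [l <= d_(k+2)]. Minimality, or
    [q_1 < n] when [k = 0], gives [q_(k+1) + q_k <= n], hence [l >= 1]. *)
Lemma interval_exists (d : nat -> nat) (n : nat) :
  (forall i, 1 <= i -> 1 <= d i) -> q d 1 < n ->
  exists k l, 1 <= l <= d k.+2 /\
    l * q d k.+1 + q d k <= n < l.+1 * q d k.+1 + q d k.
Proof.
move=> d_pos lt_n.
have ex_k : exists k, n < q d k.+2 + q d k.+1.
  exists n; have : n.+2 <= q d n.+2.
    rewrite -cf_den_slope cf_den_ge // => i; exact: slope_quotients_gt0.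
  by lia.
case: (ex_minnP ex_k) => k lt_k min_k; exists k, ((n - q d k) %/ q d k.+1).
have q1_gt0 := q_gt0 k.+1 d_pos.
have le_k : q d k.+1 + q d k <= n.
  case: k {lt_k q1_gt0} min_k => [|k] min_k; first by rewrite /= in lt_n *; lia.
  by rewrite leqNgt; apply/negP => /min_k; rewrite ltnn.
have := leq_divM (n - q d k) (q d k.+1).
have := ltn_ceil (n - q d k) q1_gt0.
set l := _ %/ _ => lt_l le_l; split; last by lia.
rewrite qSS in lt_k; apply/andP; split; first by nia.
by rewrite -ltnS -(ltn_pmul2r q1_gt0) mulSn; lia.
Qed.

End Denominators.

(** * Lie complexity on each range of lengths *)

Lemma Lie_complexity_interval (R : realType) (alpha : R) (d : nat -> nat)
    (s : nat -> bool) (n k l : nat) :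
  irrational alpha -> (0 < alpha < 1)%R -> (forall i, 1 <= i -> 1 <= d i) ->
  has_cfrac alpha (slope_quotients d) -> Sturmian_word alpha s ->
  1 <= l <= d k.+2 -> l * q d k.+1 + q d k <= n < l.+1 * q d k.+1 + q d k ->
  Lie_complexity s n = (q d k.+1 %| n) || (l * q d k.+1 + q d k %| n).
Proof.
move=> alpha_irr /andP[alpha_gt0 alpha_lt1] d_pos alpha_cf s_sturm l_bnd n_bnd.
pose a := slope_quotients d.
have a_gt0 i : 0 < a i.+1 by exact: slope_quotients_gt0.
have q0_gt0 := q_gt0 k d_pos; have lt_q := q_ltS k d_pos.
rewrite (Lie_complexity_farey _ alpha_irr alpha_gt0 s_sturm); last by lia.
  have side m := cf_side m a_gt0 alpha_irr alpha_cf.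
  have [hSS _] := cf_recurrence a k.
  have := side k; have := side k.+1; have := side k.+2.
  have := natr_cf_det R a k.
  rewrite {}hSS !cf_den_slope qSS -[a k.+2]/(d k.+2).
  move: (cf_num a k.+1) (cf_num a k) => h1 h0; rewrite !natrD !natrM !exprS.
  pose b := l * q d k.+1 + q d k; pose c := l * h1 + h0.
  (* With [h_j / q_j] the convergents, [alpha * b - c] is [alpha * q_(k+2) - h_(k+2)] minus
     [d_(k+2) - l] times [alpha * q_(k+1) - h_(k+1)]. These two differences have opposite signs, so
     [c / b] lies on the side of the convergent of index [k + 2]. *)
  have dl_ge0 : (0 <= (d k.+2)%:R - l%:R :> R)%R.
    by rewrite subr_ge0 ler_nat; case/andP: l_bnd.
  have detP x y x' y' : (x'%:R * y%:R = x%:R * y'%:R + 1 :> R)%R -> x' * y = x * y' + 1.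
    by move=> E; apply/eqP; rewrite -(eqr_nat R) natrD !natrM E.
  have bR : (b%:R = l%:R * (q d k.+1)%:R + (q d k)%:R :> R)%R by rewrite natrD natrM.
  have cR : (c%:R = l%:R * h1%:R + h0%:R :> R)%R by rewrite natrD natrM.
  (* For odd [k] the convergent [h1 / q d k.+1] is the lower neighbour and [c / b] the upper one;
     for even [k] they are exchanged. *)
  rewrite -signr_odd; case: (odd k); rewrite ?expr0 ?expr1 => det s2 s1 s0.
    rewrite (@card_farey_adjacent _ _ h1 (q d k.+1) c b) ?(ltW alpha_lt1) //.
    - by lra.
    - by rewrite bR cR; nra.
    - by apply: detP; rewrite bR cR; lra.
    - by nia.
    - by rewrite /b; nia.
    - by rewrite /b; lia.
  rewrite (@card_farey_adjacent _ _ c b h1 (q d k.+1)) ?(ltW alpha_lt1) //.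
  - by rewrite orbC.
  - by rewrite bR cR; nra.
  - by lra.
  - by apply: detP; rewrite bR cR; lra.
  - by rewrite /b; nia.
  - by nia.
  - by rewrite /b; lia.
by move=> eps; exact: small_excess.
Qed.

Lemma Lie_complexity0 (A : finType) (s : nat -> A) : Lie_complexity s 0 = 1.
Proof.
rewrite /Lie_complexity -(cards1 (conj_class [tuple of [::] : seq A])).
apply: eq_card => C; rewrite !inE; apply/andP/eqP => [[/imsetP[w _ ->] _]| ->].
  by rewrite [w]tuple0; congr conj_class; exact: val_inj.
split; first exact: imset_f.
by apply/forall_inP => v _; apply/asboolP; exists 0; rewrite [v]tuple0.
Qed.

(** The neighbours are [0 / 1] and [1 / n], because the convergent [1 / q_1] lies above [alpha];
    both denominators divide [n]. *)
Lemma Lie_complexity_small (R : realType) (alpha : R) (d : nat -> nat)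
    (s : nat -> bool) (n : nat) :
  irrational alpha -> (0 < alpha)%R -> (forall i, 1 <= i -> 1 <= d i) ->
  has_cfrac alpha (slope_quotients d) -> Sturmian_word alpha s ->
  1 <= n <= q d 1 -> Lie_complexity s n = 2.
Proof.
move=> alpha_irr alpha_gt0 d_pos alpha_cf s_sturm n_bnd.
pose a := slope_quotients d.
have a_gt0 i : 0 < a i.+1 by exact: slope_quotients_gt0.
rewrite (Lie_complexity_farey _ alpha_irr alpha_gt0 s_sturm); last by lia.
  have lt_n : (alpha * n%:R < 1%:R)%R.
    have := cf_side 1 a_gt0 alpha_irr alpha_cf.
    rewrite cf_den_slope expr1 mulN1r oppr_gt0 subr_lt0; apply: le_lt_trans.
    by rewrite ler_pM2l // ler_nat; case/andP: n_bnd.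
  have lt_1n : 1 < n.+1 by lia.
  have adjP p : farey_adjacent alpha p n <-> p * 1 = 0 * n \/ p * n = 1 * n.
    by apply: farey_adjacentP => //; rewrite ?mulr1 //; lia.
  rewrite -[RHS](_ : #|[set ord0; Ordinal lt_1n]%SET| = 2); last by rewrite cards2.
  apply: eq_card => p; rewrite !inE; apply/asboolP/orP.
    move/adjP => -[pE|pE]; [left|right]; apply/eqP/val_inj => /=; first by lia.
    by apply/eqP; rewrite -(@eqn_pmul2r n) ?pE //; lia.
  by move=> pE; apply/adjP; case: pE => /eqP ->; [left|right].
by move=> eps; exact: small_excess.
Qed.

Theorem theorem4 (R : realType) (alpha : R) (d : nat -> nat) (s : nat -> bool)
  (alpha_irr : irrational alpha)
  (alpha_bnd : (0 < alpha < 1 / 2)%R)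
  (d_pos : forall i : nat, 1 <= i -> 1 <= d i)
  (alpha_cf : has_cfrac alpha (slope_quotients d))
  (s_sturm : Sturmian_word alpha s) :
  Lie_complexity s 0 = 1 /\
  (forall n : nat, 1 <= n <= q d 1 -> Lie_complexity s n = 2) /\
  (forall n : nat, q d 1 < n ->
     let special :=
       (exists k l : nat, [/\ 2 <= k, 1 <= l < d k & n = q_semi d k l]) \/
       (exists k m : nat, [/\ 1 <= k, 1 <= m <= d k.+1 + 1 & n = m * q d k]) in
     (special -> Lie_complexity s n = 1) /\
     (~ special -> Lie_complexity s n = 0)).
Proof.
have alpha_gt0 : (0 < alpha)%R by case/andP: alpha_bnd.
have alpha_lt1 : (0 < alpha < 1)%R by lra.
split; first exact: Lie_complexity0.
split; first by move=> n; exact: (Lie_complexity_small alpha_irr alpha_gt0 d_pos).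
move=> n lt_n special.
have LieE k l := @Lie_complexity_interval R alpha d s n k l
  alpha_irr alpha_lt1 d_pos alpha_cf s_sturm.
have q0_gt0 k := q_gt0 k d_pos; have lt_q k := q_ltS k d_pos.
split.
  case=> [[[|[|k]] [l [// _ l_bnd nE]]]|[[|k] [m [// _ m_bnd nE]]]].
    rewrite /q_semi subn1 subn2 /= -/(q d k.+1) in nE.
    have := LieE k l; rewrite -nE dvdnn orbT; apply; first by lia.
    by have := q0_gt0 k.+1; rewrite leqnn mulSn; lia.
  have [m_le1|m_gt1] := leqP m 1.
    have m1 : m = 1 by lia.
    (* [n = q d 1] is excluded by [lt_n]; a later [q d k.+2] starts the interval with
       [l = d k.+2]. *)
    rewrite m1 mul1n in nE; case: k => [|k] in m_bnd nE *; first by lia.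
    have := LieE k (d k.+2); rewrite -qSS -nE dvdnn orbT; apply.
      by rewrite d_pos /=.
    by have := q0_gt0 k.+1; rewrite leqnn mulSn -addnA -qSS -nE; lia.
  (* Since [0 < q_k < q_(k+1)], the multiple [m * q_(k+1)] lies in the interval with [l = m - 1]. *)
  have [m' mE] : exists m', m = m'.+1 by exists m.-1; lia.
  have := LieE k m'; rewrite nE dvdn_mull //; apply; first by lia.
  by have := lt_q k; have := q0_gt0 k; rewrite mE mulSn; lia.
move=> not_special; have [k [l [l_bnd n_bnd]]] := interval_exists d_pos lt_n.
rewrite (LieE k l) //.
have /negbTE-> : ~~ (q d k.+1 %| n).
  apply/negP => /dvdnP[m mE]; apply: not_special; right; exists k.+1, m.
  have := lt_q k; have := q0_gt0 k => q_pos lt_qk.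
  (* As [0 < q_k < q_(k+1)], the interval contains no other multiple of [q_(k+1)]. *)
  have ml : m = l.+1 by nia.
  by split=> //; lia.
have /negbTE-> // : ~~ (l * q d k.+1 + q d k %| n).
apply/negP => /dvdnP[m mE]; apply: not_special.
have := lt_q k; have := q0_gt0 k => q_pos lt_qk.
(* Because [l >= 1], twice the left endpoint is already outside the interval. *)
have m1 : m = 1 by nia.
rewrite m1 mul1n in mE.
have [lt_ld|le_dl] := ltnP l (d k.+2).
  left; exists k.+2, l; split=> //; first by lia.
  by rewrite /q_semi subn1 subn2.
right; exists k.+2, 1; split=> //; first by lia.
by rewrite mul1n qSS mE; congr (_ * _ + _); lia.
Qed.
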